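(* Let $(D,M)$ be a complete local integral domain that is not a field, with $\operatorname{char}(D/M)=0$. If $D$ is an AV-domain (or an API-domain), then $D$ is a DVR; consequently $D\cong K[[X]]$, where $K\cong D/M$ is a coefficient field for $D$.
   Context: A local ring is a Noetherian ring with a unique maximal ideal; a complete local ring is one complete in its $M$-adic topology. A coefficient field of a complete local ring $(D,M)$ is a subfield mapping isomorphically onto $D/M$. An integral domain $D$ is an AV-domain (almost valuation domain) if for all nonzero $a,b\in D$ there is a natural number $n$ with $a^n\mid b^n$ or $b^n\mid a^n$ in $D$. $D$ is an API-domain (almost principal ideal domain) if for every nonempty subset $\{d_\alpha\}_{\alpha\in\Lambda}$ of $D\setminus\{0\}$ there is a natural number $n$ such that the ideal $(\{d_\alpha^n\}_{\alpha\in\Lambda})$ is principal. A DVR is a rank-one discrete valuation domain, i.e. a local PID that is not a field. *)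

(* Defs.v *)
From mathcomp Require Import all_boot all_order all_algebra.
Set Implicit Arguments. Unset Strict Implicit. Unset Printing Implicit Defensive.
Import GRing.Theory.
Local Open Scope ring_scope.

Section Defs.
Variable D : idomainType.

Definition ideal (I : D -> Prop) : Prop :=
  [/\ I 0, (forall x y, I x -> I y -> I (x + y)) & (forall r x, I x -> I (r * x))].

Definition maximal_ideal (I : D -> Prop) : Prop :=
  [/\ ideal I, ~ I 1 &
      forall J, ideal J -> (forall x, I x -> J x) -> J 1 \/ (forall x, J x -> I x)].

Definition generated (S : D -> Prop) (x : D) : Prop :=
  exists s : seq (D * D), (forall p, p \in s -> S p.2) /\ x = \sum_(p <- s) p.1 * p.2.

Definition finitely_generated (I : D -> Prop) : Prop :=
  exists s : seq D, forall x, I x <-> generated (fun y => y \in s) x.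

Definition noetherian : Prop := forall I, ideal I -> finitely_generated I.

Definition local_ring (M : D -> Prop) : Prop :=
  [/\ noetherian, maximal_ideal M &
      forall N, maximal_ideal N -> forall x, N x <-> M x].

Fixpoint ipow (M : D -> Prop) (n : nat) : D -> Prop :=
  match n with
  | 0 => fun _ => True
  | n'.+1 => generated (fun y => exists a b, [/\ M a, ipow M n' b & y = a * b])
  end.

Definition madic_complete (M : D -> Prop) : Prop :=
  forall u : nat -> D,
    (forall n, exists N, forall i j, (N <= i)%N -> (N <= j)%N -> ipow M n (u i - u j)) ->
    exists L, forall n, exists N, forall i, (N <= i)%N -> ipow M n (u i - L).

Definition is_field : Prop := forall x : D, x != 0 -> x \is a GRing.unit.

Definition residue_char0 (M : D -> Prop) : Prop :=
  forall n : nat, (0 < n)%N -> ~ M n%:R.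

Definition divides (a b : D) : Prop := exists c, b = c * a.

Definition AV_domain : Prop :=
  forall a b : D, a != 0 -> b != 0 ->
    exists n : nat, (0 < n)%N /\ (divides (a ^+ n) (b ^+ n) \/ divides (b ^+ n) (a ^+ n)).

Definition principal (I : D -> Prop) : Prop :=
  exists g, forall x, I x <-> exists r, x = r * g.

Definition API_domain : Prop :=
  forall S : D -> Prop, (exists d, S d) -> (forall d, S d -> d != 0) ->
    exists n : nat, (0 < n)%N /\
      principal (generated (fun y => exists d, S d /\ y = d ^+ n)).

Definition PID : Prop := forall I, ideal I -> principal I.

Definition DVR : Prop := [/\ PID, exists M, local_ring M & ~ is_field].

(* K is a subfield of D mapping isomorphically onto D/M *)
Definition subfield (K : D -> Prop) : Prop :=
  [/\ K 1, (forall x y, K x -> K y -> K (x - y)), (forall x y, K x -> K y -> K (x * y))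
    & (forall x, K x -> x != 0 -> x \is a GRing.unit /\ K x^-1)].

Definition coefficient_field (M K : D -> Prop) : Prop :=
  [/\ subfield K,
      (forall k, K k -> M k -> k = 0) &
      (forall d, exists k, K k /\ M (d - k))].

Definition ps_add (f g : nat -> D) : nat -> D := fun n => f n + g n.
Definition ps_mul (f g : nat -> D) : nat -> D :=
  fun n => \sum_(i < n.+1) f i * g (n - i)%N.
Definition ps_const (c : D) : nat -> D := fun n => if n == 0%N then c else 0.

(* D is isomorphic to K[[X]] (as K-algebras), K a subfield of D;
   K[[X]] is represented by the sequences nat -> D with all values in K. *)
Definition iso_power_series (K : D -> Prop) : Prop :=
  exists phi : D -> nat -> D,
    [/\ (forall d n, K (phi d n)),
        (forall x y, (forall n, phi x n = phi y n) -> x = y),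
        (forall f : nat -> D, (forall n, K (f n)) -> exists d, forall n, phi d n = f n)
      & [/\ (forall x y n, phi (x + y) n = ps_add (phi x) (phi y) n),
        (forall x y n, phi (x * y) n = ps_mul (phi x) (phi y) n) &
        (forall k, K k -> forall n, phi k n = ps_const k n)]].

End Defs.

(* Main.v *)
(* Let [F] be the fraction field of [D].  In the almost valuation domain [D] (API reduces to AV
   because [D] is local) every [z] integral over [D] has a power in [D].  Let [x ^ n] be in [D].
   For every [y] in [Z[x]] some [(1 + 3 y) ^ m] is in [D]; expanding it and dividing by [3 m],
   which is a unit of [D], gives [s y + 3 w] in [D] with [w] in [Z[x]] and [s] prime to 3.  With
   [A] the intersection of [D] and [Z[x]], this says that [Z[x]] is [A + 3 Z[x]] up to integers
   prime to 3, and Nakayama's determinant trick puts [x] in [D], unless [3] becomes invertible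
   modulo [M D[x]] in the localization of [Z[x]] at 3.  The exception cannot hold for both [x]
   and [x^-1], and not at all if [x ^ n] is in [M].  Hence [D] is a Noetherian valuation ring.
   Completeness only enters afterwards: Newton iteration shows that a maximal subfield is a
   coefficient field, and elements are expanded in powers of a uniformizer. *)
Require Import Defs.
From mathcomp Require Import all_boot all_order all_fingroup all_algebra.
From mathcomp Require Import ring zify.
From mathcomp Require Import boolp classical_sets.
Set Implicit Arguments. Unset Strict Implicit. Unset Printing Implicit Defensive.
Import GRing.Theory.
Local Open Scope ring_scope.

(** * Subrings and ideals inside an ambient ring, and determinants modulo an ideal *)

Definition subring (R : pzRingType) (A : R -> Prop) : Prop :=
  [/\ A 1, forall x y, A x -> A y -> A (x - y) & forall x y, A x -> A y -> A (x * y)].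

Definition ideal_of (R : pzRingType) (A I : R -> Prop) : Prop :=
  [/\ I 0, forall x y, I x -> I y -> I (x - y) & forall r x, A r -> I x -> I (r * x)].

Section Subrings.
Variables (R : comNzRingType) (A : R -> Prop).
Hypothesis hA : subring A.

Lemma subring1 : A 1. Proof. by case: hA. Qed.
Lemma subringB x y : A x -> A y -> A (x - y). Proof. by case: hA => _ h _; exact: h. Qed.
Lemma subringM x y : A x -> A y -> A (x * y). Proof. by case: hA => _ _; exact. Qed.
Lemma subring0 : A 0.
Proof. by rewrite -(subrr 1); apply: subringB; exact: subring1. Qed.
Lemma subringN x : A x -> A (- x).
Proof. by rewrite -sub0r; apply: subringB; exact: subring0. Qed.
Lemma subringD x y : A x -> A y -> A (x + y).
Proof. by move=> Ax /subringN Ay; rewrite -[y]opprK; exact: subringB. Qed.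
Lemma subringX x n : A x -> A (x ^+ n).
Proof.
by move=> Ax; elim: n => [|n IH]; [exact: subring1 | rewrite exprS; exact: subringM].
Qed.
Lemma subring_sum (T : Type) (r : seq T) (P : pred T) (f : T -> R) :
  (forall i, P i -> A (f i)) -> A (\sum_(i <- r | P i) f i).
Proof. by move=> h; apply: big_ind => //; [exact: subring0 | exact: subringD]. Qed.
Lemma subring_prod (T : Type) (r : seq T) (P : pred T) (f : T -> R) :
  (forall i, P i -> A (f i)) -> A (\prod_(i <- r | P i) f i).
Proof. by move=> h; apply: big_ind => //; [exact: subring1 | exact: subringM]. Qed.
Lemma subring_nat n : A n%:R.
Proof.
elim: n => [|n IH]; first exact: subring0.
by rewrite -natr1; apply: subringD => //; exact: subring1.
Qed.
Lemma subring_int (n : int) : A n%:~R.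
Proof.
case: n => n; first exact: subring_nat.
by rewrite NegzE mulrNz; apply: subringN; exact: subring_nat.
Qed.
Lemma subring_sign n : A ((-1) ^+ n).
Proof. by apply/subringX/subringN/subring1. Qed.

Lemma subring_det n (N : 'M[R]_n) : (forall i j, A (N i j)) -> A (\det N).
Proof.
move=> AN; apply: subring_sum => s _; apply: subringM; first exact: subring_sign.
exact: subring_prod.
Qed.

Lemma subring_adj n (N : 'M[R]_n) i j : (forall i j, A (N i j)) -> A ((\adj N) i j).
Proof.
move=> AN; rewrite mxE; apply: subringM; first exact: subring_sign.
by apply: subring_det => a b; rewrite !mxE.
Qed.

Variable I : R -> Prop.
Hypothesis hI : ideal_of A I.

Lemma ideal_of0 : I 0. Proof. by case: hI. Qed.
Lemma ideal_ofB x y : I x -> I y -> I (x - y). Proof. by case: hI => _ h _; exact: h. Qed.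
Lemma ideal_ofM r x : A r -> I x -> I (r * x). Proof. by case: hI => _ _; exact. Qed.
Lemma ideal_ofN x : I x -> I (- x).
Proof. by rewrite -sub0r; apply: ideal_ofB; exact: ideal_of0. Qed.
Lemma ideal_ofD x y : I x -> I y -> I (x + y).
Proof. by move=> Ax /ideal_ofN Ay; rewrite -[y]opprK; exact: ideal_ofB. Qed.
Lemma ideal_of_sum (T : Type) (r : seq T) (P : pred T) (f : T -> R) :
  (forall i, P i -> I (f i)) -> I (\sum_(i <- r | P i) f i).
Proof. by move=> h; apply: big_ind => //; [exact: ideal_of0 | exact: ideal_ofD]. Qed.

Hypothesis IA : forall x, I x -> A x.

(** Expand over permutations: the identity gives the product of the [s i + E i i], and any other
    permutation moves some [i], so its term has an off-diagonal factor, which lies in [I]. *)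
Lemma det_diag_mod n (s : 'I_n -> R) (E : 'M[R]_n) :
  (forall i, A (s i)) -> (forall i j, I (E i j)) ->
  I (\det (diag_mx (\row_i s i) + E) - \prod_i s i).
Proof.
move=> As IE; set N := _ + E.
have Nii i : N i i = s i + E i i by rewrite !mxE eqxx.
have Nij i j : i != j -> N i j = E i j by move=> ne; rewrite !mxE (negbTE ne) add0r.
have AN i j : A (N i j).
  have [->|ne] := eqVneq i j; last by rewrite Nij //; apply: IA.
  by rewrite Nii; apply: subringD => //; apply: IA.
rewrite /determinant (bigD1 (1%g : 'S_n)) //= odd_perm1 expr0 mul1r addrAC; apply: ideal_ofD.
  under eq_bigr do rewrite perm1.
  suff [] : I (\prod_i N i i - \prod_i s i) /\ A (\prod_i s i) by [].
  apply: (big_rec2 (fun a b => I (a - b) /\ A b)).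
    by rewrite subrr; split; [exact: ideal_of0 | exact: subring1].
  move=> i a b _ [Iab Ab]; split; last exact: subringM.
  have -> : N i i * a - s i * b = N i i * (a - b) + b * E i i by rewrite Nii; ring.
  by apply: ideal_ofD; apply: ideal_ofM.
apply: ideal_of_sum => t tn1; apply: ideal_ofM; first exact: subring_sign.
have [i ti] : exists i, t i != i.
  apply/existsP; rewrite -negb_forall; apply: contra tn1 => /forallP h.
  by apply/eqP/permP => i; rewrite perm1; exact/eqP.
rewrite (bigD1 i) //= mulrC; apply: ideal_ofM; first exact: subring_prod.
by rewrite Nij // eq_sym.
Qed.

End Subrings.

Lemma det_scale (R : comNzRingType) n (N : 'M[R]_n) (v c : 'cV[R]_n) i :
  N *m v = c -> \det N * v i 0 = \sum_j (\adj N) i j * c j 0.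
Proof.
move=> h; have /matrixP/(_ i 0) : \adj N *m (N *m v) = \adj N *m c by rewrite h.
by rewrite mulmxA mul_adj_mx mul_scalar_mx !mxE => ->.
Qed.

(* [s * C(m, i) * 3 ^ i / (9 m)] is an integer because [C(m, i) / m = C(m - 1, i - 1) / i] and
   [3 ^ (i - 2) / i] is 3-integral for [i >= 2]. *)
Lemma bin_scale m : (0 < m)%N -> exists2 s, ~~ (3 %| s)%N &
  forall i, (1 < i <= m)%N -> exists e, (s * 'C(m, i) * 3 ^ i = 9 * m * e)%N.
Proof.
(* The product of the prime-to-3 parts of 1, ..., [m] clears the prime-to-3 part of every
   denominator [i] at once. *)
move=> m0; exists (\prod_(j < m) j.+1`_(3^'))%N.
  apply: (big_ind (fun k => ~~ (3 %| k)%N)) => // [a b|j _].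
    by rewrite Euclid_dvdM // negb_or => ->.
  by rewrite -p'natE ?part_gt0 //; exact: part_pnat.
move=> [//|i] /andP[i1 im].
rewrite (bigD1 (Ordinal im)) //=; set P := (\prod_(j < m | _) _)%N.
have := logn_part 3 i.+1; set v := logn 3 i.+1 => _.
have i3 : (i.+1 = 3 ^ v * i.+1`_3^')%N by rewrite -p_part partnC.
(* For [v > 0] this comes from [v + 2 <= 3 ^ v <= i.+1]. *)
have vi : (v + 2 <= i.+1)%N.
  have [->//|v0] := posnP v.
  have : (3 ^ v <= i.+1)%N by rewrite i3 leq_pmulr ?part_gt0.
  apply: leq_trans; case: v v0 {i3} => // v _.
  elim: v => // v IH; rewrite expnS; lia.
have bd : (m * 'C(m.-1, i) = i.+1 * 'C(m, i.+1))%N by rewrite mul_bin_diag.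
exists (P * 'C(m.-1, i) * 3 ^ (i.+1 - v - 2))%N.
have -> : (3 ^ i.+1 = 3 ^ v * 3 ^ (i.+1 - v - 2) * 9)%N.
  by rewrite -[9%N]/(3 ^ 2)%N -!expnD; congr (_ ^ _)%N; lia.
set a := (i.+1`_3^')%N in i3 *; set b := (3 ^ (_ - _))%N.
transitivity ((3 ^ v * a) * 'C(m, i.+1) * P * b * 9)%N; first by nia.
rewrite -i3 -bd; nia.
Qed.

(** Expanding [s * (1 + 3 y) ^ m - s] gives [3 m s y] plus terms of degree at least 2, whose
    coefficients are divisible by [9 m] for a suitable [s]. Dividing by [3 m], a unit of [O], leaves
    [s y + 3 w]. *)
Lemma power_to_linear (F : fieldType) (O B : F -> Prop) (y : F) m :
  subring O -> subring B -> (forall k, (0 < k)%N -> O k%:R^-1) ->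
  (forall k, (0 < k)%N -> k%:R != 0 :> F) ->
  B y -> (0 < m)%N -> O ((1 + 3%:R * y) ^+ m) ->
  exists s w, [/\ ~~ (3 %| s)%N, B w & O (s%:R * y + 3%:R * w)].
Proof.
move=> hO hB Oinv char0 By; case: m => // m _ Om.
have [s s3 es] := bin_scale (ltn0Sn m).
(* The exponent is now [m.+1], and [e i] belongs to degree [i + 2]; the value 0 out of range is a
   placeholder. *)
have /choice[e eE] : forall i, exists e, (i < m)%N ->
    (s * 'C(m.+1, i.+2) * 3 ^ i.+2 = 9 * m.+1 * e)%N.
  move=> i; have [lt_im|] := boolP (i < m)%N; last by exists 0%N.
  by have [|e h] := es i.+2; [|exists e].
pose w := \sum_(i < m) (e i)%:R * y ^+ i.+2.
exists s, w; split=> //.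
  apply: subring_sum => // i _; apply: subringM => //; first exact: subring_nat.
  exact: subringX.
suff -> : s%:R * y + 3%:R * w = (3 * m.+1)%:R^-1 * (s%:R * (1 + 3%:R * y) ^+ m.+1 - s%:R).
  apply: subringM => //; first exact: Oinv.
  by apply: subringB => //; [apply: subringM => // |]; apply: subring_nat.
have c0 : (3 * m.+1)%:R != 0 :> F by apply: char0.
apply: (mulfI c0); rewrite mulrA divff // mul1r exprDn.
rewrite big_ord_recl big_ord_recl /= expr0 expr1n mulr1 bin0 mulr1n.
rewrite expr1n mul1r expr1 bin1.
under eq_bigr => i _.
  rewrite expr1n mul1r exprMn -mulr_natl /bump !add1n -natrX.
  over.
rewrite [s%:R * (1 + _)]mulrDr mulr1 [RHS]addrC addKr !mulrDr.
congr (_ + _); first by rewrite -mulr_natl natrM; ring.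
rewrite /w mulr_sumr !mulr_sumr; apply: eq_bigr => i _.
move: (eE i (ltn_ord i)); set c := (3 ^ _)%N => {}/(congr1 (fun k => k%:R : F)).
rewrite -/c; move: c => c; rewrite !natrM => h.
have -> : s%:R * ('C(m.+1, i.+2)%:R * (c%:R * y ^+ i.+2)) =
  (s%:R * 'C(m.+1, i.+2)%:R * c%:R) * y ^+ i.+2 :> F by ring.
rewrite h; ring.
Qed.

(** * Almost valuation rings with residue characteristic 0 are valuation rings *)

Section IntPolys.
Variables (F : fieldType) (x : F) (N : F -> Prop).
Local Notation ev := (fun p : {poly int} => (map_poly intr p).[x]).

(* Modulo 3 the first polynomial is a nonzero constant and the second one a monomial of top
   degree, so either the leading term of [p] or the constant term of [q] can be removed. *)
Lemma no_opposite_polys (x0 : x != 0) (char0 : forall k, (0 < k)%N -> ~ N k%:R)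
    (NB : forall a b, N a -> N b -> N (a - b))
    (Nx : forall a, N a -> N (x * a)) (NV : forall a, N a -> N (x^-1 * a))
    (n k : nat) (p q : {poly int}) :
  (size p <= n.+1)%N -> (size q <= k.+1)%N -> N (ev p) -> N (ev q) ->
  ~~ (3 %| p`_0)%Z -> (forall i, (0 < i)%N -> (3 %| p`_i)%Z) ->
  ~~ (3 %| q`_k)%Z -> (forall i, (i < k)%N -> (3 %| q`_i)%Z) -> False.
Proof.
have N0 a : N a -> N 0 by move=> Na; rewrite -(subrr a); exact: NB.
have NN a : N a -> N (- a) by move=> Na; rewrite -sub0r; apply: NB => //; exact: N0 Na.
have ND a b : N a -> N b -> N (a + b) by move=> Na /NN Nb; rewrite -[b]opprK; exact: NB.
have Nint (z : int) a : N a -> N (z%:~R * a).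
  move=> Na; have Nn j : N (j%:R * a).
    elim: j => [|j IH]; first by rewrite mul0r; exact: N0 Na.
    by rewrite -natr1 mulrDl mul1r; apply: ND.
  by case: z => j; rewrite ?NegzE ?mulrNz ?mulNr; [|apply: NN]; apply: Nn.
have NX j a : N a -> N (x ^+ j * a).
  by move=> Na; elim: j => [|j IH]; rewrite ?mul1r // exprS -mulrA; apply: Nx.
have cst (c : int) : ~~ (3 %| c)%Z -> ~ N c%:~R.
  move=> c3 Nc; have : c != 0 by apply: contraNneq c3 => ->; rewrite dvdz0.
  case: c Nc {c3} => c Nc c0; first by apply: (char0 c) => //; rewrite lt0n.
  by apply: (char0 c.+1) => //; rewrite -[_%:R]opprK; apply: NN; rewrite NegzE mulrNz in Nc.
have dvdB (a b : int) : (3 %| a)%Z -> (3 %| b)%Z -> (3 %| a - b)%Z by exact: rpredB.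
have dvdM3 (a b : int) : ~~ (3 %| a)%Z -> ~~ (3 %| b)%Z -> ~~ (3 %| a * b)%Z.
  by rewrite !dvdzE abszM Euclid_dvdM // negb_or => -> ->.
move: {2}(n + k)%N (leqnn (n + k)) => l.
elim: l n k p q => [|l IH] n k p q lnk sp sq Np Nq p0 pi qk qi.
  have n0 : n = 0 by lia.
  apply: (cst _ p0); move: Np; rewrite (size1_polyC (p := p)); last by rewrite n0 in sp.
  by rewrite map_polyC hornerC coefC.
case: n sp lnk => [|n] sp lnk.
  apply: (cst _ p0); move: Np; rewrite (size1_polyC sp).
  by rewrite map_polyC hornerC coefC.
case: k sq lnk qk qi => [|k] sq lnk qk qi.
  apply: (cst _ qk); move: Nq; rewrite (size1_polyC sq).
  by rewrite map_polyC hornerC coefC.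
have [le_kn|lt_nk] := leqP k n.
  (* The coefficient of degree [n.+1] cancels. The constant coefficient is a product of two integers
     prime to 3, up to a multiple of 3. *)
  pose p' := q`_k.+1 *: p - p`_n.+1 *: ('X^(n - k) * q).
  have p'E i : p'`_i = q`_k.+1 * p`_i - p`_n.+1 * (if (i < n - k)%N then 0 else q`_(i - (n - k))).
    by rewrite coefB !coefZ coefXnM.
  apply: (IH n k.+1 p' q) => //.
  - apply/leq_sizeP => j; rewrite leq_eqVlt => /predU1P[<-|lt_nj].
      rewrite p'E ifN; last lia.
      have -> : (n.+1 - (n - k) = k.+1)%N by lia.
      by rewrite mulrC subrr.
    rewrite p'E ifN; last lia.
    have -> : p`_j = 0 by apply/nth_default/(leq_trans sp).
    have -> : q`_(j - (n - k)) = 0 by apply/nth_default/(leq_trans sq); lia.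
    by rewrite !mulr0 subr0.
  - rewrite /p' rmorphB /= !map_polyZ rmorphM /= map_polyXn hornerD hornerN !hornerZ hornerM hornerXn.
    by apply: NB; apply: Nint => //; apply: NX.
  - rewrite p'E; case: ifP => [_|].
      by rewrite mulr0 subr0 dvdM3.
    have [->|nk0] := eqVneq (n - k)%N 0; last by lia.
    rewrite subnn => _; apply/negP => h; apply: (negP (dvdM3 _ _ qk p0)).
    by rewrite -[_ * _](subrK (p`_n.+1 * q`_0)) rpredD ?dvdz_mulr ?pi.
  move=> i i0; rewrite p'E; apply: dvdB; first by rewrite dvdz_mull ?pi.
  by rewrite dvdz_mulr ?pi.
(* The constant coefficient cancels, so [X] divides [q'] and can be removed by the stability of [N]
   under [x^-1]. The coefficient of degree [k.+1] stays prime to 3, that of [p] being divisible by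
   3. *)
pose q' := p`_0 *: q - q`_0 *: p.
have q'0 : q'`_0 = 0 by rewrite coefB !coefZ; ring.
pose r := \poly_(i < k.+1) q'`_i.+1.
have sq' : (size q' <= k.+2)%N.
  rewrite (leq_trans (size_polyD _ _)) // geq_max size_polyN.
  apply/andP; split; apply: leq_trans (size_scale_leq _ _) _; first exact: sq.
  by apply: (leq_trans sp); rewrite !ltnS ltnW.
have q'E : q' = r * 'X.
  apply/polyP => -[|i]; rewrite coefMX //= coef_poly; case: ltnP => // lt_ki.
  by rewrite nth_default // (leq_trans sq').
apply: (IH n.+1 k p r) => //.
- lia.
- exact: size_poly.
- have : N (ev q').
    by rewrite /q' rmorphB /= !map_polyZ hornerD hornerN !hornerZ; apply: NB; apply: Nint.
  rewrite q'E rmorphM /= map_polyX hornerMX => /NV.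
  by rewrite mulrCA mulVf ?mulr1.
- rewrite coef_poly ltnSn /q' coefB !coefZ; apply/negP => h; apply: (negP (dvdM3 _ _ p0 qk)).
  by rewrite -[_ * _](subrK (q`_0 * p`_k.+1)) rpredD ?dvdz_mull ?pi.
move=> i lt_ik; rewrite coef_poly ltnW // /q' coefB !coefZ.
by apply: dvdB; [rewrite dvdz_mull ?qi | rewrite dvdz_mulr ?qi].
Qed.
End IntPolys.

(** * Rings generated by one element, and exponents modulo [n] *)

Section Spans.
Variables (R : comNzRingType) (x : R).
Local Notation ev := (fun p : {poly int} => (map_poly intr p).[x]).

(** This is [P[x]] for a subring [P], and the extension of [P] to [O[x]] when [P] is an ideal of
    [O]. *)
Definition poly_span (P : R -> Prop) (y : R) : Prop :=
  exists2 q : {poly R}, forall i, P q`_i & y = q.[x].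

Definition int_span (y : R) : Prop := exists p : {poly int}, y = ev p.

Lemma subring_int_span : subring int_span.
Proof.
split=> [|_ _ [p ->] [q ->]|_ _ [p ->] [q ->]].
- by exists 1; rewrite rmorph1 hornerC.
- by exists (p - q); rewrite rmorphB /= hornerD hornerN.
- by exists (p * q); rewrite rmorphM /= hornerM.
Qed.

Lemma subring_span (O : R -> Prop) : subring O -> subring (poly_span O).
Proof.
move=> hO; split=> [|_ _ [p Op ->] [q Oq ->]|_ _ [p Op ->] [q Oq ->]].
- exists 1; last by rewrite hornerC.
  by move=> i; rewrite coef1; apply: subring_nat.
- exists (p - q); last by rewrite hornerD hornerN.
  by move=> i; rewrite coefB; apply: subringB.
- exists (p * q); last by rewrite hornerM.
  by move=> i; rewrite coefM; apply: subring_sum => // j _; apply: subringM.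
Qed.

Lemma int_span_span (O : R -> Prop) y : subring O -> int_span y -> poly_span O y.
Proof.
move=> hO [p ->]; exists (map_poly intr p) => // i.
by rewrite coef_map; apply: subring_int.
Qed.

(** The power [x ^ i] is [x ^ (i %% n)] times a power of [x ^ n], which is in [A] and is absorbed
    into the coefficient. *)
Lemma span_reduce (A P : R -> Prop) n (q : {poly R}) : subring A -> ideal_of A P ->
  (0 < n)%N -> A (x ^+ n) -> (forall i, P q`_i) ->
  exists2 r : 'I_n -> R, forall j, P (r j) & q.[x] = \sum_j r j * x ^+ j.
Proof.
move=> hA hP n0 Axn Pq; rewrite horner_coef.
apply: (big_ind (fun y => exists2 r : 'I_n -> R, forall j, P (r j) & y = \sum_j r j * x ^+ j)).
- exists (fun=> 0); first by move=> _; apply: ideal_of0 hP.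
  by rewrite big1 // => j _; rewrite mul0r.
- move=> _ _ [r Pr ->] [t Pt ->]; exists (fun j => r j + t j).
    by move=> j; apply: (ideal_ofD hP).
  by rewrite -big_split /=; apply: eq_bigr => j _; rewrite mulrDl.
move=> i _; have lt_in : (i %% n < n)%N by rewrite ltn_mod.
exists (fun j => if j == Ordinal lt_in then (x ^+ n) ^+ (i %/ n) * q`_i else 0).
  move=> j; case: ifP => _; last exact: ideal_of0 hP.
  by apply: (ideal_ofM hP) => //; apply: subringX.
rewrite (bigD1 (Ordinal lt_in)) //= eqxx big1 ?addr0; last by move=> j /negPf ->; rewrite mul0r.
have -> : x ^+ i = (x ^+ n) ^+ (i %/ n) * x ^+ (i %% n) by rewrite -exprM mulnC -exprD -divn_eq.
by rewrite mulrA [q`_i * _]mulrC.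
Qed.

End Spans.

Section AlmostValuation.
Variables (F : fieldType) (O MM : F -> Prop).
Hypotheses (hO : subring O) (hM : ideal_of O MM) (MO : forall y, MM y -> O y) (M1 : ~ MM 1).
Hypothesis unitO : forall y, O y -> ~ MM y -> O y^-1.
Hypothesis char0 : forall k, (0 < k)%N -> ~ MM k%:R.
Hypothesis av : forall z, z != 0 -> exists2 m, (0 < m)%N & O (z ^+ m) \/ O (z ^- m).

Section PowerIn.
Variables (x : F) (n : nat).
Hypotheses (n0 : (0 < n)%N) (Oxn : O (x ^+ n)).

(** Nakayama: otherwise, multiplying by [x ^ i] writes the vector of the [x ^ i], [i < n], as a
    matrix over [MM] times itself. The identity minus this matrix kills a vector with first entry 1,
    so its determinant is 0, yet congruent to 1 modulo [MM]. *)
Lemma one_notin_span : ~ poly_span x MM 1.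
Proof.
case=> q Mq q1.
have /choice[m hm] : forall i : 'I_n, exists r : 'I_n -> F,
    (forall j, MM (r j)) /\ x ^+ i = \sum_j r j * x ^+ j.
  move=> i; have [|r Mr rE] := @span_reduce F x O MM n ('X^i * q) hO hM n0 Oxn.
    by move=> j; rewrite coefXnM; case: ifP => _; [apply: ideal_of0 hM|].
  by exists r; split=> //; rewrite -rE hornerM hornerXn -q1 mulr1.
pose E : 'M[F]_n := - \matrix_(i, j) m i j.
have ME i j : MM (E i j) by rewrite !mxE; apply: (ideal_ofN hM); case: (hm i).
have := det_diag_mod hO hM MO (s := fun=> 1) (fun=> subring1 hO) ME.
set N := _ + E; rewrite big1 // => Mdet.
pose v : 'cV[F]_n := \col_i x ^+ i.
have Nv : N *m v = 0.
  apply/matrixP => i k; rewrite mulmxDl mul_diag_mx mulNmx !mxE mul1r.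
  by rewrite (proj2 (hm i)); apply/eqP; rewrite subr_eq0; apply/eqP/eq_bigr => j _; rewrite !mxE.
have := det_scale (Ordinal n0) Nv; rewrite !mxE /= mulr1 big1; last by move=> j _; rewrite [X in _ * X]mxE mulr0.
move=> det0; apply: M1; move: Mdet; rewrite det0 sub0r => /(ideal_ofN hM).
by rewrite opprK.
Qed.

(** If only [z ^- m] is in [O], it is a unit of [O] or lies in [MM]; in the second case
    [1 = z ^- m * z ^ m] lies in the extension of [MM] to [O[x]], which is excluded. *)
Lemma power_in z : poly_span x O z -> exists2 m, (0 < m)%N & O (z ^+ m).
Proof.
move=> Oz; have [->|z0] := eqVneq z 0.
  by exists 1%N => //; rewrite expr1; exact: subring0.
have [m m0 [|Ow]] := av z0; first by exists m.
exists m => //; have [Mw|/(unitO Ow)] := pselect (MM (z ^- m)); last by rewrite invrK.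
exfalso; apply: one_notin_span.
have [q Oq qE] := subringX (subring_span x hO) m Oz.
exists (z ^- m *: q) => [i|]; last by rewrite hornerZ -qE mulVf ?expf_neq0.
by rewrite coefZ mulrC; apply: (ideal_ofM hM).
Qed.

(** The linearized relations give a matrix [N] over [A] that sends the vector of powers of [x] into
    [O], so [\det N * x] is in [O] by Cramer's rule. Modulo [3 A], [\det N] is a product of integers
    prime to 3, so the hypothesis keeps it out of [MM]. *)
Lemma mem_of_det_unit :
  (forall s (p : {poly int}), ~~ (3 %| s)%N -> ~ MM (s%:R + 3%:R * (map_poly intr p).[x])) ->
  O x.
Proof.
move=> good; have hB := subring_int_span x; set B := int_span x in hB.
have Bx : B x by exists 'X; rewrite map_polyX hornerX.
pose A y := O y /\ B y.
have hA : subring A.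
  split; first by split; apply: subring1.
  - by move=> a b [? ?] [? ?]; split; apply: subringB.
  - by move=> a b [? ?] [? ?]; split; apply: subringM.
have idA : ideal_of A A.
  by split; [exact: subring0 | exact: subringB hA | exact: subringM hA].
pose I y := exists2 a, A a & y = 3%:R * a.
have hI : ideal_of A I.
  split; first by exists 0; [exact: subring0 | rewrite mulr0].
  - by move=> _ _ [a Aa ->] [b Ab ->]; exists (a - b); [exact: subringB | rewrite mulrBr].
  - by move=> r _ Ar [a Aa ->]; exists (r * a); [exact: subringM | rewrite mulrCA].
have IA y : I y -> A y by case=> a Aa ->; apply: subringM => //; apply: subring_nat.
have Ox0 k : (0 < k)%N -> k%:R != 0 :> F.
  by move=> k0; apply/eqP => h; apply: (char0 k0); rewrite h; exact: ideal_of0 hM.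
have Axn : A (x ^+ n) by split=> //; apply: subringX.
(* Row [i] comes from a power of [1 + 3 x ^ i] that lies in [O]; the error term in [Z[x]] is reduced
   to exponents below [n], with coefficients in [A]. *)
have /choice[f hf] : forall i : 'I_n, exists sr : nat * ('I_n -> F),
    [/\ ~~ (3 %| sr.1)%N, forall j, A (sr.2 j) &
        O (sr.1%:R * x ^+ i + 3%:R * \sum_j sr.2 j * x ^+ j)].
  move=> i; have Bxi : B (x ^+ i) by apply: subringX.
  have [|m m0 Om] := @power_in (1 + 3%:R * x ^+ i).
    apply: int_span_span => //; apply: subringD => //; first exact: subring1.
    by apply: subringM => //; apply: subring_nat.
  have [|s [w [s3 [p wE] Osw]]] := power_to_linear hO hB _ Ox0 Bxi m0 Om.
    by move=> k k0; apply: unitO; [exact: subring_nat | exact: char0].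
  have [|r Ar rE] := @span_reduce F x A A n (map_poly intr p) hA idA n0 Axn.
    by move=> j; rewrite coef_map; apply: subring_int.
  by exists (s, r); split=> //; rewrite -rE -wE.
pose s i := (f i).1.
pose E : 'M[F]_n := \matrix_(i, j) (3%:R * (f i).2 j).
have AE i j : I (E i j) by rewrite mxE; exists ((f i).2 j) => //; case: (hf i).
have As i : A (s i)%:R by apply: subring_nat.
have := det_diag_mod hA hI IA As AE.
set N := _ + E => -[d [_ [p dE]] detE].
pose v : 'cV[F]_n := \col_i x ^+ i.
have Ndet : ~ MM (\det N).
  rewrite -[\det N](subrK (\prod_i (s i)%:R)) detE dE addrC -natr_prod; apply: good.
  apply: (big_ind (fun k => ~~ (3 %| k)%N)) => // [a b|j _].
    by rewrite Euclid_dvdM // negb_or => ->.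
  by case: (hf j).
have AN i j : A (N i j).
  rewrite !mxE; apply: subringD => //; last by apply: IA; have := AE i j; rewrite mxE.
  by case: eqP => _; [rewrite mulr1n | rewrite mulr0n; apply: subring0].
have ON i j : O (N i j) by case: (AN i j).
have Oc i : O ((N *m v) i 0).
  have [_ _] := hf i; congr O; rewrite mulmxDl mul_diag_mx !mxE; congr (_ + _).
  by rewrite mulr_sumr; apply: eq_bigr => j _; rewrite !mxE mulrA.
have Odx i : O (\det N * v i 0).
  rewrite (det_scale i (erefl (N *m v))); apply: subring_sum => // j _.
  by apply: subringM => //; apply: subring_adj.
(* The entry [x] of the vector has index 1, so [n = 1] is treated apart. *)
have [n1|n1] := leqP n 1.
  have n1' : n = 1%N by apply/eqP; rewrite eqn_leq n1.
  by move: Oxn; rewrite n1' expr1.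
have := Odx (Ordinal n1); rewrite mxE expr1 => Odx1.
have Od : O (\det N) by apply: subring_det.
have d0 : \det N != 0 by apply/eqP => h; apply: Ndet; rewrite h; exact: ideal_of0 hM.
by rewrite -[x](mulKf d0); apply: subringM => //; apply: unitO.
Qed.

End PowerIn.

Lemma unit_nat_3 s (c : int) : ~~ (3 %| s)%N -> ~ MM (s%:R + 3%:R * c%:~R).
Proof.
move=> s3; have -> : s%:R + 3%:R * c%:~R = (s%:Z + 3 * c)%:~R :> F.
  by rewrite rmorphD rmorphM.
have : (s%:Z + 3 * c) != 0 by lia.
move: (_ + _) => z z0 Mz; apply: (@char0 `|z|%N); first by rewrite absz_gt0.
case: z Mz {z0} => k //=; rewrite NegzE mulrNz => /(ideal_ofN hM).
by rewrite opprK.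
Qed.

(** If [s + 3 p(x)] were in [MM], subtracting it from its constant term [t], an integer prime to 3,
    would give a unit of [O] that is [x] times an element of [Z[x]]. Its [n]-th power has the factor
    [x ^ n] in [MM], so 1 would lie in the extension of [MM] to [O[x]]. *)
Lemma mem_of_power_mem_max x n : (0 < n)%N -> MM (x ^+ n) -> O x.
Proof.
move=> n0 Mxn; have Oxn := MO Mxn.
apply: (mem_of_det_unit n0 Oxn) => s p s3 Mdet.
apply: (one_notin_span n0 Oxn).
have pE : p = drop_poly 1 p * 'X + (p`_0)%:P.
  rewrite -[LHS](poly_take_drop 1) expr1 addrC; congr (_ + _).
  by apply/polyP => i; rewrite coef_take_poly coefC; case: i.
pose t := s%:R + 3%:R * (p`_0)%:~R : F.
have Mt : ~ MM t by exact: unit_nat_3.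
have Ot : O t by apply: subringD => //; [|apply: subringM => //; last exact: subring_int]; exact: subring_nat.
pose y := (map_poly intr (drop_poly 1 p)).[x] : F.
have evE : (map_poly intr p).[x] = y * x + (p`_0)%:~R.
  by rewrite {1}pE rmorphD rmorphM /= map_polyX map_polyC hornerD hornerMX hornerC.
set u := s%:R + 3%:R * (map_poly intr p).[x] in Mdet.
have tE : t - u = - (3%:R * y) * x by rewrite /t /u evE; ring.
have Mtu : ~ MM (t - u).
  by move=> /(ideal_ofD hM Mdet); rewrite addrC subrK.
have tu0 : t - u != 0 by apply/eqP => h; apply: Mtu; rewrite h; exact: ideal_of0 hM.
have Otu : O (t - u)^-1 by apply: unitO => //; apply: subringB => //; exact: MO.
have : poly_span x O (- (3%:R * y)).
  apply: (subringN (subring_span x hO)); apply: (subringM (subring_span x hO)).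
    exact: (subring_nat (subring_span x hO)).
  by apply: int_span_span => //; exists (drop_poly 1 p).
move=> /(subringX (subring_span x hO) n)[q Oq qE].
exists (((t - u)^-1 ^+ n * x ^+ n) *: q) => [i|].
  rewrite coefZ mulrC mulrA; apply: (ideal_ofM hM) => //.
  by apply: subringM => //; apply: subringX.
by rewrite hornerZ -qE -exprMn -exprMn -mulrA [x * _]mulrC -tE mulVf // expr1n.
Qed.

(** When [x ^ n] is a unit of [O], failure of the determinant criterion for both [x] and [x^-1]
    gives two integer polynomials with values at [x] in the extended ideal, one a nonzero constant
    modulo 3 and the other a monomial; [no_opposite_polys] forbids this. *)
Lemma mem_or_inv_mem x n : (0 < n)%N -> O (x ^+ n) -> O x \/ O x^-1.
Proof.
move=> n0 Oxn; have [/(mem_of_power_mem_max n0)|Mxn] := pselect (MM (x ^+ n)); first by left.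
have [bad|good] := pselect (exists s (p : {poly int}), ~~ (3 %| s)%N /\
    MM (s%:R + 3%:R * (map_poly intr p).[x])); last first.
  left; apply: (mem_of_det_unit n0 Oxn) => s p s3 Mp; apply: good.
  by exists s, p.
right; have OxnV : O (x^-1 ^+ n) by rewrite exprVn; apply: unitO.
apply: (mem_of_det_unit n0 OxnV) => t q t3 Mq.
case: bad => s [p [s3 Mp]].
have x0 : x != 0.
  by apply/eqP => h; apply: Mxn; rewrite h expr0n gtn_eqF //; exact: ideal_of0 hM.
have hS := subring_span x hO.
have hN : ideal_of (poly_span x O) (poly_span x MM).
  split; first by exists 0 => [i|]; rewrite ?horner0 // coef0; exact: ideal_of0 hM.
  - move=> _ _ [a Ma ->] [b Mb ->]; exists (a - b) => [i|]; last by rewrite hornerD hornerN.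
    by rewrite coefB; apply: (ideal_ofB hM).
  - move=> _ _ [a Ma ->] [b Mb ->]; exists (a * b) => [i|]; last by rewrite hornerM.
    by rewrite coefM; apply: (ideal_of_sum hM) => j _; apply: (ideal_ofM hM).
have cst a : O a -> poly_span x O a.
  move=> Oa; exists a%:P => [i|]; last by rewrite hornerC.
  by rewrite coefC; case: eqP => _ //; exact: subring0.
have cstM a : MM a -> poly_span x MM a.
  move=> Oa; exists a%:P => [i|]; last by rewrite hornerC.
  by rewrite coefC; case: eqP => _ //; exact: ideal_of0 hM.
have Sx : poly_span x O x.
  by exists 'X => [i|]; rewrite ?hornerX // coefX; exact: subring_nat.
have SxV : poly_span x O x^-1.
  have -> : x^-1 = x ^- n * x ^+ n.-1.
    by apply: (mulfI (expf_neq0 n x0)); rewrite mulVKf ?expf_neq0 // -[in LHS](prednK n0) exprSr mulfK.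
  by apply: (subringM hS); [rewrite -exprVn; exact: cst | exact: subringX].
pose P := (s%:Z)%:P + 3%:Z *: p : {poly int}.
pose k := size q.
(* This is [X ^ k] times [t + 3 q(1/X)]; its top coefficient is [t + 3 q(0)]. *)
pose Q := t%:Z *: 'X^k + 3%:Z *: \poly_(i < k.+1) q`_(k - i).
apply: (@no_opposite_polys F x (poly_span x MM) x0 _ _ _ _ (size P) k P Q).
- move=> j j0 /(ideal_ofM hN (cst _ _)) h; apply: (one_notin_span n0 Oxn).
  rewrite -(mulVf (_ : j%:R != 0)); last first.
    by apply/eqP => h0; apply: (char0 j0); rewrite h0; exact: ideal_of0 hM.
  by apply: h; apply: unitO; [exact: subring_nat | exact: char0].
- exact: ideal_ofB hN.
- by move=> a; apply: (ideal_ofM hN).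
- by move=> a; apply: (ideal_ofM hN).
- exact: leqnSn.
- rewrite (leq_trans (size_polyD _ _)) // geq_max; apply/andP; split.
    by rewrite (leq_trans (size_scale_leq _ _)) // size_polyXn.
  by rewrite (leq_trans (size_scale_leq _ _)) // size_poly.
- rewrite /P rmorphD /= map_polyC map_polyZ hornerD hornerC hornerZ; exact: cstM.
- have -> : (map_poly intr Q).[x] = x ^+ k * (t%:R + 3%:R * (map_poly intr q).[x^-1]).
    rewrite rmorphD /= !map_polyZ map_polyXn hornerD !hornerZ hornerXn mulrDr.
    congr (_ + _); first by rewrite mulrC.
    rewrite mulrCA; congr (_ * _).
    rewrite (@horner_coef_wide _ k.+1); last by rewrite (leq_trans (size_poly _ _)) ?size_poly.
    rewrite (@horner_coef_wide _ k.+1 (map_poly intr q)); last first.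
      by rewrite (leq_trans (size_poly _ _)) // leqnSn.
    rewrite mulr_sumr (reindex_inj rev_ord_inj) /=; apply: eq_bigr => i _.
    have mcoef (r : {poly int}) j : (map_poly intr r)`_j = (r`_j)%:~R :> F by rewrite coef_map.
    have ik : (i <= k)%N by rewrite -ltnS.
    rewrite (mcoef q) mcoef coef_poly subSS ltnS leq_subr subKn //.
    rewrite mulrCA; congr (_ * _).
    by rewrite -[in X in _ = X * _](subnK ik) exprD exprVn mulfK ?expf_neq0.
  apply: (ideal_ofM hN); first exact: subringX.
  exact: cstM.
- by rewrite coefD coefC eqxx coefZ; lia.
- by case=> // i _; rewrite coefD coefC add0r coefZ dvdz_mulr.
- rewrite coefD !coefZ coefXn eqxx coef_poly ltnSn; lia.
move=> i lt_ik; rewrite coefD !coefZ coefXn ltn_eqF // mulr0 add0r; exact: dvdz_mulr.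
Qed.

Lemma almost_valuation_mem x : x != 0 -> O x \/ O x^-1.
Proof.
move=> x0; have [m m0 [Om|Om]] := av x0; first exact: mem_or_inv_mem Om.
by rewrite -exprVn in Om; have := mem_or_inv_mem m0 Om; rewrite invrK => -[]; [right|left].
Qed.

End AlmostValuation.

(** * Local domains *)

Lemma fractionP (D : idomainType) (z : {fraction D}) :
  exists n d, d != 0 /\ z * FracField.tofrac d = FracField.tofrac n.
Proof.
elim/quotW: z => x; exists (frac x).1, (frac x).2; split; first exact: denom_ratioP.
unlock FracField.tofrac; rewrite -[LHS]FracField.pi_mul; apply/eqP.
rewrite FracField.equivf_def /FracField.mulf !numden_Ratio ?mulr1 ?denom_ratioP ?oner_neq0 //.
by rewrite mulrC.
Qed.

Section LocalDomain.
Variables (D : idomainType) (M : D -> Prop).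
Hypothesis locM : local_ring M.

Lemma max_idealM : ideal M. Proof. by case: locM => _ []. Qed.
Lemma max_ideal1 : ~ M 1. Proof. by case: locM => _ []. Qed.

Lemma ideal_mulr (I : D -> Prop) r x : ideal I -> I x -> I (r * x).
Proof. by case=> _ _; apply. Qed.

Lemma principal_ideal (x : D) : ideal (divides x).
Proof.
split; first by exists 0; rewrite mul0r.
- by move=> _ _ [a ->] [b ->]; exists (a + b); rewrite mulrDl.
- by move=> r _ [a ->]; exists (r * a); rewrite mulrA.
Qed.

Lemma unit_notin_max x : x \is a GRing.unit -> ~ M x.
Proof.
move=> Ux Mx; apply: max_ideal1; rewrite -(mulVr Ux).
exact: ideal_mulr max_idealM Mx.
Qed.

(** By Zorn's lemma a nonunit lies in a maximal ideal, and [M] is the only one. *)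
Lemma notin_max_unit x : ~ M x -> x \is a GRing.unit.
Proof.
move=> Mx; apply: contrapT => nUx; apply: Mx.
pose good (I : set D) := [/\ ideal I, ~ I 1 & I x].
have good_xD : good (divides x).
  split; [exact: principal_ideal| |by exists 1; rewrite mul1r].
  by case=> c h; apply: nUx; apply/unitrPr; exists c; rewrite mulrC.
have [|A [PA maxA]] := @Zorn_bigcup D (fun I => I = set0 \/ good I).
  move=> C CP totC; have [[I0 [CI0 I0n]]|none] := pselect (exists I, C I /\ I <> set0); last first.
    left; apply/seteqP; split=> // y [I CI Iy]; apply: none; exists I; split=> // h.
    by rewrite h in Iy.
  right; have gd I : C I -> I <> set0 -> good I by move=> /CP [].
  have gd' I y : C I -> I y -> good I by move=> CI Iy; apply: gd => // h; rewrite h in Iy.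
  have [[z0 _ _] _ x0] := gd _ CI0 I0n.
  split; [split|by move=> [I CI I1]; have [] := gd' _ _ CI I1|by exists I0].
  - by exists I0.
  - move=> a b [I CI Ia] [J CJ Jb]; have [[_ Iadd _] _ _] := gd' _ _ CI Ia.
    have [[_ Jadd _] _ _] := gd' _ _ CJ Jb.
    have [sub|sub] := totC _ _ CI CJ.
      by exists J => //; apply: Jadd => //; exact: sub.
    by exists I => //; apply: Iadd => //; exact: sub.
  - by move=> r a [I CI Ia]; exists I => //; have [[_ _ h] _ _] := gd' _ _ CI Ia; exact: h.
have An : A <> set0.
  move=> A0; apply: (maxA (divides x)); last by right.
  by rewrite A0; split=> // h; case: (h x); exists 1; rewrite mul1r.
case: PA => // -[iA A1 Ax]; have maximalA : maximal_ideal A.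
  split=> // J iJ AJ; have [J1|J1] := pselect (J 1); [by left | right].
  apply: contrapT => nJA; apply: (maxA J); first by split.
  by right; split=> //; apply: AJ.
by case: locM => _ _ /(_ _ maximalA x) [h _]; apply: h.
Qed.

(** Take the subset [{a, b}], with [a ^ n = r g], [b ^ n = s g] and [(a ^ n, b ^ n) = (g)]. If [r]
    and [s] were both in [M], then [g] would be in [M g], forcing 1 into [M]; so one of them is a
    unit. *)
Lemma API_AV : API_domain D -> AV_domain D.
Proof.
move=> api a b a0 b0.
have [|_ [->|->] //|n [n0 [g gP]]] := api (fun y => y = a \/ y = b); first by exists a; left.
exists n; split=> //.
have gen y : y = a \/ y = b -> exists r, y ^+ n = r * g.
  move=> Sy; apply/gP; exists [:: (1, y ^+ n)]; split; last by rewrite big_seq1 mul1r.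
  by move=> p; rewrite inE => /eqP ->; exists y.
have [r ar] := gen a (or_introl erefl); have [s bs] := gen b (or_intror erefl).
have g0 : g != 0.
  by apply: contraNneq a0 => g0; move/eqP: ar; rewrite g0 mulr0 expf_eq0 => /andP[].
have /gP[t [St]] : exists r, g = r * g by exists 1; rewrite mul1r.
have [Mr|/notin_max_unit Ur] := pselect (M r); last first.
  by move=> _; left; exists (s / r); rewrite ar bs mulrA divrK.
have [Ms|/notin_max_unit Us] := pselect (M s); last first.
  by move=> _; right; exists (r / s); rewrite ar bs mulrA divrK.
move=> gE; exfalso; apply: max_ideal1.
suff [m Mm mE] : exists2 m, M m & g = m * g.
  by have := mulIf g0 (_ : 1 * g = m * g); rewrite mul1r => /(_ mE) ->.
have [M0 MD MM] := max_idealM.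
rewrite {1}gE big_seq; apply: (big_ind (fun y => exists2 m, M m & y = m * g)).
- by exists 0; rewrite ?mul0r.
- by move=> _ _ [m Mm ->] [k Mk ->]; exists (m + k); [exact: MD | rewrite mulrDl].
move=> p /St[_ [[->|->] ->]]; first by exists (p.1 * r); [exact: MM | rewrite ar mulrA].
by exists (p.1 * s); [exact: MM | rewrite bs mulrA].
Qed.

Hypothesis char0 : residue_char0 M.

(** In the fraction field, with [O] the image of [D], [almost_valuation_mem] puts [b / a] or its
    inverse in [O]. *)
Lemma AV_valuation (a b : D) : AV_domain D -> divides a b \/ divides b a.
Proof.
move=> av.
have [->|a0] := eqVneq a 0; first by right; exists 0; rewrite mul0r.
have [->|b0] := eqVneq b 0; first by left; exists 0; rewrite mul0r.
pose F := {fraction D}; pose f := @FracField.tofrac D : D -> F.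
have fE x : f x = 0 -> x = 0 by move/eqP; rewrite tofrac_eq0 => /eqP.
have f0 x : x != 0 -> f x != 0 by rewrite tofrac_eq0.
pose O (y : F) := exists d, y = f d.
pose MM (y : F) := exists2 d, M d & y = f d.
have [M0 MD MMul] := max_idealM.
have hO : subring O.
  split; first by exists 1; rewrite /f tofrac1.
  - by move=> _ _ [x ->] [y ->]; exists (x - y); rewrite /f tofracB.
  - by move=> _ _ [x ->] [y ->]; exists (x * y); rewrite /f tofracM.
have hM : ideal_of O MM.
  split; first by exists 0; rewrite // /f tofrac0.
  - move=> _ _ [x Mx ->] [y My ->]; exists (x - y); last by rewrite /f tofracB.
    by apply: MD => //; rewrite -mulN1r; exact: MMul.
  - by move=> _ _ [x ->] [y My ->]; exists (x * y); [exact: MMul | rewrite /f tofracM].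
have MMf x : MM (f x) -> M x.
  by case=> y My /eqP; rewrite tofrac_eq => /eqP ->.
have [||||||[c cE]|[c cE]] := @almost_valuation_mem F O MM hO hM _ _ _ _ _ (f b / f a) => //.
- by move=> _ [x _ ->]; exists x.
- by rewrite -[1]/(1 : F) -(tofrac1 D) => /MMf/max_ideal1.
- move=> _ [x ->] nMx; have Ux : x \is a GRing.unit.
    by apply: notin_max_unit => Mx; apply: nMx; exists x.
  exists x^-1; apply: (mulfI (f0 x _)); first by apply: contraTneq Ux => ->; rewrite unitr0.
  by rewrite mulfV ?f0 -?tofracM ?mulrV ?tofrac1 //; apply: contraTneq Ux => ->; rewrite unitr0.
- by move=> k k0; rewrite -[k%:R](rmorph_nat f) => /MMf; exact: char0.
- move=> z z0; have [n [d [d0 zE]]] := fractionP z.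
  have n0 : n != 0.
    by apply: contraNneq (mulf_neq0 z0 (f0 d d0)) => n0; rewrite zE n0 tofrac0.
  have fd0 k : f d ^+ k != 0 by rewrite expf_neq0 ?f0.
  have fn0 k : f n ^+ k != 0 by rewrite expf_neq0 ?f0.
  have {}zE : z = f n / f d by rewrite -[f n]zE mulfK ?f0.
  have [k [k0 [[c cE]|[c cE]]]] := av n d n0 d0; exists k => //.
    right; exists c; rewrite zE expr_div_n invf_div; apply: (mulIf (fn0 k)).
    by rewrite divfK ?fn0 // /f -!tofracXn cE tofracM.
  left; exists c; rewrite zE expr_div_n; apply: (mulIf (fd0 k)).
  by rewrite divfK ?fd0 // /f -!tofracXn cE tofracM.
- by rewrite mulf_neq0 ?invr_eq0 ?f0.
- left; exists c; apply/eqP; rewrite -tofrac_eq tofracM; apply/eqP.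
  by rewrite -[_ c]cE divfK ?f0.
right; exists c; apply/eqP; rewrite -tofrac_eq tofracM; apply/eqP.
by rewrite -[_ c]cE invf_div divfK ?f0.
Qed.

End LocalDomain.

(** * Complete discrete valuation rings *)

(** Among finitely many generators one divides all the others; 0 serves for the empty list. *)
Lemma valuation_PID (D : idomainType) :
  noetherian D -> (forall a b : D, divides a b \/ divides b a) -> PID D.
Proof.
move=> noeth val I hI; have [s sI] := noeth I hI.
have [g gs sg] : exists2 g, forall y, y \in s -> divides g y & g = 0 \/ g \in s.
  elim: {sI} s => [|y s [g gs sg]]; first by exists 0 => //; left.
  have [[c cE]|[c cE]] := val g y.
    exists g => [z|]; last by case: sg => [|gs']; [left|right; rewrite inE gs' orbT].
    by rewrite inE => /predU1P[->|/gs//]; exists c.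
  exists y => [z|]; last by right; rewrite mem_head.
  rewrite inE => /predU1P[->|/gs[e ->]]; first by exists 1; rewrite mul1r.
  by exists (e * c); rewrite cE mulrA.
have [I0 _ IM] := hI.
exists g => x; split=> [/sI[t [ts ->]]|[r ->]].
  rewrite big_seq; apply: (big_ind (divides g)).
  - by case: (principal_ideal g).
  - by case: (principal_ideal g) => _ h _; exact: h.
  by move=> p /ts/gs; case: (principal_ideal g) => _ _; apply.
apply: IM; case: sg => [->//|gs']; apply/sI; exists [:: (1, g)].
by rewrite big_seq1 mul1r; split=> // p; rewrite inE => /eqP ->.
Qed.

(** For [x] nonzero, [I] is the intersection of [D] and [x D[1/pi]]. Its generator satisfies
    [g pi ^ j = r x], and [c = x / pi ^ j.+1] is in [I], say [c = t g]. Then [x = pi t r x], so [pi]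
    would be a unit. *)
Lemma PID_separated (D : idomainType) (pi x : D) : PID D -> pi \isn't a GRing.unit -> pi != 0 ->
  (forall k, divides (pi ^+ k) x) -> x = 0.
Proof.
move=> pid nU pi0 xpi; apply/eqP/negPn/negP => x0.
pose I y := exists j r, y * pi ^+ j = r * x.
have [|g gP] := pid I.
  split; first by exists 0%N, 0; rewrite !mul0r.
  - move=> a b [i [r ra]] [j [s sb]]; exists (i + j)%N, (r * pi ^+ j + s * pi ^+ i).
    by rewrite mulrDl exprD mulrA ra [pi ^+ i * _]mulrC mulrA sb; ring.
  - by move=> r a [i [s sa]]; exists i, (r * s); rewrite -mulrA sa mulrA.
have /gP[j [r gE]] : exists r, g = r * g by exists 1; rewrite mul1r.
have [c cE] := xpi j.+1.
have /gP[t tE] : I c by exists j.+1, 1; rewrite mul1r.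
apply: (negP nU); apply/unitrPr; exists (t * r).
have : x * (pi * (t * r)) = x * 1.
  transitivity (pi * t * (g * pi ^+ j)); first by rewrite gE; ring.
  by rewrite mulr1 cE tE exprS; ring.
exact: mulfI.
Qed.

Lemma ipow_principal (D : idomainType) (M : D -> Prop) (pi : D) k x :
  (forall y, M y <-> divides pi y) -> ipow M k x <-> divides (pi ^+ k) x.
Proof.
move=> Mpi; elim: k x => [|k IH] x.
  by split=> // _; exists x; rewrite mulr1.
split=> [[s [sP ->]]|[c ->]].
  rewrite big_seq; have [d0 dD dM] := principal_ideal (pi ^+ k.+1).
  apply: big_ind => // p /sP[a [b [/Mpi[c ->] /IH[d ->] ->]]].
  by apply: dM; exists (c * d); rewrite exprS; ring.
exists [:: (c, pi ^+ k.+1)]; rewrite big_seq1; split=> // p; rewrite inE => /eqP -> /=.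
exists pi, (pi ^+ k); split; [|apply/IH|by rewrite exprS].
  by apply/Mpi; exists 1; rewrite mul1r.
by exists 1; rewrite mul1r.
Qed.

Lemma taylor2 (R : comNzRingType) (p : {poly R}) (u h : R) :
  exists r, p.[u + h] = p.[u] + p^`().[u] * h + r * h ^+ 2.
Proof.
elim/poly_ind: p => [|p c [r rE]].
  by exists 0; rewrite deriv0 !horner0; ring.
exists (p^`().[u] + r * (u + h)).
by rewrite derivMXaddC !hornerMXaddC hornerD hornerMX rE; ring.
Qed.

(** * Hensel lifting and coefficient fields *)

Section CompleteDVR.
Variables (D : idomainType) (M : D -> Prop) (pi : D).
Hypotheses (pi0 : pi != 0) (Mpi : forall x, M x <-> divides pi x) (nM1 : ~ M 1).
Hypothesis unitM : forall x, ~ M x -> x \is a GRing.unit.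
Hypothesis sep : forall x, (forall k, divides (pi ^+ k) x) -> x = 0.
Hypothesis complete : forall u : nat -> D, (forall k, divides (pi ^+ k) (u k.+1 - u k)) ->
  exists L, forall k, divides (pi ^+ k) (u k - L).
Hypothesis char0 : forall n, (0 < n)%N -> ~ M n%:R.

Lemma dvdD (d x y : D) : divides d x -> divides d y -> divides d (x + y).
Proof. by case: (principal_ideal d) => _ h _; exact: h. Qed.
Lemma dvdMl (d r x : D) : divides d x -> divides d (r * x).
Proof. by case: (principal_ideal d) => _ _; apply. Qed.
Lemma dvd0 (d : D) : divides d 0. Proof. by case: (principal_ideal d). Qed.
Lemma dvdN (d x : D) : divides d x -> divides d (- x).
Proof. by rewrite -mulN1r; exact: dvdMl. Qed.
Lemma dvdB (d x y : D) : divides d x -> divides d y -> divides d (x - y).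
Proof. by move=> dx /dvdN; exact: dvdD. Qed.
Lemma dvd_exp (d : D) i j : (i <= j)%N -> divides (d ^+ i) (d ^+ j).
Proof. by move=> ij; exists (d ^+ (j - i)); rewrite -exprD subnK. Qed.
Lemma dvd_trans (d x y : D) : divides d x -> divides x y -> divides d y.
Proof. by move=> [a ->] [b ->]; exists (b * a); rewrite mulrA. Qed.

Lemma idM : ideal_of (fun=> True) M.
Proof.
split; first by apply/Mpi; exact: dvd0.
- by move=> x y /Mpi dx /Mpi dy; apply/Mpi/dvdB.
- by move=> r x _ /Mpi dx; apply/Mpi/dvdMl.
Qed.

Lemma unitNM x : x \is a GRing.unit -> ~ M x.
Proof. by move=> Ux Mx; apply: nM1; rewrite -(mulVr Ux); exact: (ideal_ofM idM). Qed.

Lemma horner_congr (d : D) (p : {poly D}) x y : divides d (x - y) -> divides d (p.[x] - p.[y]).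
Proof.
move=> [c cE]; have -> : x = y + c * d by rewrite -cE addrC subrK.
have [r ->] := taylor2 p y (c * d).
by exists (p^`().[y] * c + r * c ^+ 2 * d); ring.
Qed.

(** Newton iteration: the first two Taylor terms at [u k] cancel, and the square of the correction,
    a multiple of [pi ^ k.+1], gains at least one factor [pi]. As [u k] stays congruent to [u0], the
    derivative remains a unit. *)
Lemma hensel (p : {poly D}) u0 : M p.[u0] -> ~ M p^`().[u0] ->
  exists2 e, p.[e] = 0 & M (e - u0).
Proof.
move=> Mp Mp'; pose next u := u - p.[u] / p^`().[u].
pose u k := iter k next u0.
have uP k : divides (pi ^+ k.+1) p.[u k] /\ divides pi (u k - u0).
  elim: k => [|k [pk uk]]; first by rewrite expr1 subrr; split; [apply/Mpi|exact: dvd0].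
  have Up : p^`().[u k] \is a GRing.unit.
    apply: unitM => Mk; apply: Mp'.
    have /Mpi := horner_congr p^`() uk; move=> /(ideal_ofN idM)/(ideal_ofD idM Mk).
    by rewrite opprB addrC subrK.
  have [c cE] := pk; set h := - (p.[u k] / p^`().[u k]).
  have hE : h = - (c / p^`().[u k]) * pi ^+ k.+1 by rewrite /h cE; ring.
  have uS : u k.+1 = u k + h by [].
  split; last first.
    rewrite uS addrAC; apply: dvdD => //; rewrite hE; apply: dvdMl.
    by rewrite -[X in divides X _]expr1; apply: dvd_exp.
  have [r rE] := taylor2 p (u k) h; rewrite uS rE {1}/h mulrN mulrC divrK // subrr add0r.
  apply: dvdMl; rewrite hE exprMn; apply: dvdMl; rewrite -exprM; apply: dvd_exp; lia.
have Up k : p^`().[u k] \is a GRing.unit.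
  apply: unitM => Mk; apply: Mp'.
  have /Mpi := horner_congr p^`() (proj2 (uP k)); move=> /(ideal_ofN idM)/(ideal_ofD idM Mk).
  by rewrite opprB addrC subrK.
have [k|e eP] := complete (u := u).
  rewrite [u k.+1]/(u k + - _) addrAC subrr add0r; apply: dvdN; rewrite mulrC; apply: dvdMl.
  by apply: dvd_trans (proj1 (uP k)); apply: dvd_exp.
exists e.
  apply: sep => k; rewrite -[p.[e]](subrK p.[u k]); apply: dvdD.
    by apply: horner_congr; rewrite -opprB; apply: dvdN.
  by apply: dvd_trans (proj1 (uP k)); apply: dvd_exp.
(* The limit is compared with [u 1], since divisibility by [pi ^ k] says nothing for [k = 0]. *)
apply/Mpi; rewrite -[e](subrK (u 1%N)) -addrA; apply: dvdD; last by case: (uP 1%N).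
by rewrite -opprB; apply: dvdN; rewrite -[pi]expr1.
Qed.

Lemma nat_neq0 n : (0 < n)%N -> n%:R != 0 :> D.
Proof. by move=> /char0 h; apply/eqP => e; apply: h; rewrite e; exact: ideal_of0 idM. Qed.

(** The copy of the rationals in [D]: nonzero integers avoid [M], hence are units. *)
Lemma prime_subfield :
  subfield (fun x : D => exists (a : int) (b : nat), (0 < b)%N /\ x * b%:R = a%:~R).
Proof.
split; first by exists 1, 1%N; rewrite mul1r.
- move=> x y [a [b [b0 xE]]] [c [d [d0 yE]]]; exists (a * d%:Z - c * b%:Z), (b * d)%N.
  rewrite muln_gt0 b0 d0; split=> //.
  by rewrite natrM rmorphB !rmorphM /= -xE -yE -!pmulrn; ring.
- move=> x y [a [b [b0 xE]]] [c [d [d0 yE]]]; exists (a * c), (b * d)%N.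
  rewrite muln_gt0 b0 d0; split=> //.
  by rewrite natrM rmorphM /= -xE -yE; ring.
move=> x [a [b [b0 xE]]] x0.
have a0 : a%:~R != 0 :> D by rewrite -xE mulf_neq0 ?nat_neq0.
have a0' : a != 0 by apply: contraNneq a0 => ->.
have Ua : a%:~R \is a @GRing.unit D.
  apply: unitM => Ma; apply: (@char0 `|a|%N); first by rewrite absz_gt0.
  case: a Ma {xE a0 a0'} => k //; rewrite NegzE mulrNz => /(ideal_ofN idM).
  by rewrite opprK.
have Ux : x \is a GRing.unit by move: Ua; rewrite -xE unitrM => /andP[].
have ax : a%:~R / x = b%:R by rewrite -xE mulrC mulKr.
split=> //; exists (sgz a * b%:Z), `|a|%N; rewrite absz_gt0 a0'; split=> //.
have -> : `|a|%N%:R = (sgz a)%:~R * a%:~R :> D.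
  by rewrite -rmorphM /= -abszEsg pmulrn.
by rewrite rmorphM /= -pmulrn -ax mulrC -mulrA.
Qed.

Lemma subfield_subring (K : D -> Prop) : subfield K -> subring K.
Proof. by case. Qed.

Definition maximal_subfield (K : D -> Prop) : Prop :=
  subfield K /\ forall K', subfield K' -> (forall x, K x -> K' x) -> forall x, K' x -> K x.

Lemma exists_maximal_subfield : exists K, maximal_subfield K.
Proof.
have [|A [PA maxA]] := @Zorn_bigcup D (fun K => K = set0 \/ subfield K).
  move=> C CP totC; have [[I0 [CI0 I0n]]|none] := pselect (exists I, C I /\ I <> set0); last first.
    left; apply/seteqP; split=> // y [I CI Iy]; apply: none; exists I; split=> // h.
    by rewrite h in Iy.
  right; have gd I : C I -> I <> set0 -> subfield I by move=> /CP [].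
  have gd' I y : C I -> I y -> subfield I by move=> CI Iy; apply: gd => // h; rewrite h in Iy.
  have join x y : (\bigcup_(X in C) X)%classic x -> (\bigcup_(X in C) X)%classic y ->
      exists I, [/\ C I, subfield I, I x & I y].
    move=> [I CI Ix] [J CJ Jy]; have [sub|sub] := totC _ _ CI CJ.
      by exists J; split=> //; [exact: gd' Jy | exact: sub].
    by exists I; split=> //; [exact: gd' Ix | exact: sub].
  split.
  - by exists I0 => //; case: (gd _ CI0 I0n).
  - by move=> x y /join h /h[I [CI [_ sb _ _] Ix Iy]]; exists I => //; exact: sb.
  - by move=> x y /join h /h[I [CI [_ _ ml _] Ix Iy]]; exists I => //; exact: ml.
  move=> x [I CI Ix] x0; have [_ _ _ /(_ x Ix x0)[Ux Kx]] := gd' _ _ CI Ix.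
  by split=> //; exists I.
have An : A <> set0.
  move=> A0; apply: maxA (or_intror prime_subfield); rewrite A0; split=> // h.
  by case: (h 1); exists 1, 1%N; rewrite mul1r.
case: PA => // sA; exists A; split=> // K sK AK x Kx; apply: contrapT => nAx.
by apply: (maxA K); [split=> // h; apply: nAx; exact: h | right].
Qed.

Lemma subfield_max (K : D -> Prop) x : subfield K -> K x -> M x -> x = 0.
Proof.
move=> [_ _ _ KV] Kx Mx; apply/eqP/negPn/negP => x0.
by have [/unitNM] := KV x Kx x0.
Qed.

(* [K(e)] is then a subfield of [D]. *)
Lemma maximal_subfield_adjoin (K : D -> Prop) e : maximal_subfield K ->
  (forall s, poly_span e K s -> M s -> s = 0) -> K e.
Proof.
move=> [sK maxK] he; have rK := subfield_subring sK; have rS := subring_span e rK.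
have US s : poly_span e K s -> s != 0 -> s \is a GRing.unit.
  by move=> Ss s0; apply: unitM => /(he s Ss)/eqP; exact/negP.
have KS x : K x -> poly_span e K x.
  move=> Kx; exists x%:P; last by rewrite hornerC.
  by move=> i; rewrite coefC; case: eqP => _ //; exact: subring0.
apply: (maxK (fun y => exists a b, [/\ poly_span e K a, poly_span e K b, b != 0 & y * b = a])).
- split; first by exists 1, 1; rewrite mul1r oner_neq0; split=> //; exact: subring1.
  + move=> x y [a [b [Sa Sb b0 xE]]] [c [d [Sc Sd d0 yE]]].
    exists (a * d - c * b), (b * d); split; rewrite ?mulf_neq0 //; last by rewrite -xE -yE; ring.
      by apply: subringB => //; apply: subringM.
    exact: subringM.
  + move=> x y [a [b [Sa Sb b0 xE]]] [c [d [Sc Sd d0 yE]]].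
    exists (a * c), (b * d); split; rewrite ?mulf_neq0 //; last by rewrite -xE -yE; ring.
      exact: subringM.
    exact: subringM.
  move=> x [a [b [Sa Sb b0 xE]]] x0; have a0 : a != 0 by rewrite -xE mulf_neq0.
  have Ux : x \is a GRing.unit by have := US _ Sa a0; rewrite -xE unitrM => /andP[].
  by split=> //; exists b, a; split=> //; rewrite -xE mulKr.
- move=> x Kx; exists x, 1; rewrite mulr1 oner_neq0; split=> //; first exact: KS.
  exact: subring1.
exists e, 1; rewrite mulr1 oner_neq0; split=> //; last exact: subring1.
by exists 'X => [i|]; rewrite ?hornerX // coefX; exact: subring_nat.
Qed.

(** If the residue of [d] is transcendental over [K], then [K[d]] meets [M] only in 0, and [d] is in
    [K] by maximality. Otherwise its minimal polynomial is separable in characteristic 0, and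
    Hensel's lemma lifts the residue to a root [e]; then [K[e]] meets [M] only in 0, so [e] is in
    [K]. *)
Lemma maximal_subfield_residue (K : D -> Prop) d : maximal_subfield K ->
  exists k, K k /\ M (d - k).
Proof.
move=> mK; have [sK _] := mK; have rK := subfield_subring sK.
have Mirr x y : M (x - y) -> M x -> M y.
  by move=> Mxy Mx; have := ideal_ofB idM Mx Mxy; rewrite subKr.
pose ann n := exists p : {poly D}, [/\ p != 0, forall i, K p`_i, M p.[d] & size p = n].
have [alg|transc] := pselect (exists n, ann n); last first.
  exists d; rewrite subrr; split; last exact: ideal_of0 idM.
  apply: (maximal_subfield_adjoin mK) => _ [q Kq ->] Mq; apply/eqP/negPn/negP => q0.
  apply: transc; exists (size q), q; split=> //.
  by apply: contraNneq q0 => ->; rewrite horner0.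
have exm : exists n, `[< ann n >] by case: alg => n /asboolP; exists n.
case: (ex_minnP exm) => m /asboolP[p [p0 Kp Mp sp]] minm.
have {}minm (q : {poly D}) : (forall i, K q`_i) -> M q.[d] -> (size q < size p)%N -> q = 0.
  move=> Kq Mq lt; apply/eqP/negPn/negP => q0; move: lt; rewrite ltnNge sp; apply/negP/negPn.
  by apply/minm/asboolP; exists q.
have lp0 : lead_coef p != 0 by rewrite lead_coef_eq0.
(* Otherwise minimality makes the derivative 0, so [p] is a constant in both [K] and [M], hence
   0. *)
have p'0 : ~ M p^`().[d].
  move=> Mp'; have p'0 : p^`() = 0.
    apply: minm => // [i|]; last exact: lt_size_deriv.
    by rewrite coef_deriv -mulr_natr; apply: subringM => //; exact: subring_nat.
  have s1 : (size p <= 1)%N.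
    rewrite leqNgt; apply/negP => s2; have := congr1 (fun q : {poly D} => q`_(size p).-2) p'0.
    rewrite coef0 coef_deriv => /eqP; rewrite -mulr_natr mulf_eq0.
    have -> : (size p).-2.+1 = (size p).-1 by lia.
    rewrite -lead_coefE (negbTE lp0) /= => /eqP h; have := @nat_neq0 (size p).-1.
    by rewrite h eqxx => /(_ _)/negP; apply; lia.
  move: Mp; rewrite (size1_polyC s1) hornerC => /(subfield_max sK (Kp 0%N)) c0.
  by move: p0; rewrite (size1_polyC s1) c0 eqxx.
have [e pe Med] := hensel Mp p'0.
(* Euclidean division by [p] with cross-multiplied leading coefficients: the size drops until
   minimality of [p] applies. *)
have vanish n (q : {poly D}) : (forall i, K q`_i) -> M q.[d] -> (size q <= n)%N -> q.[e] = 0.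
  elim: n q => [|n IH] q Kq Mqd.
    by rewrite size_poly_leq0 => /eqP ->; rewrite horner0.
  move=> sq; have [lt_qp|le_pq] := ltnP (size q) (size p).
    by rewrite (minm q) ?horner0.
  have sp0 : (0 < size p)%N by rewrite size_poly_gt0.
  pose r := lead_coef p *: q - lead_coef q *: ('X^(size q - size p) * p).
  have rE i : r`_i = lead_coef p * q`_i -
      lead_coef q * (if (i < size q - size p)%N then 0 else p`_(i - (size q - size p))).
    by rewrite coefB !coefZ coefXnM.
  have : r.[e] = 0.
    apply: IH.
    - move=> i; rewrite rE; apply: subringB => //; apply: subringM => //; try exact: Kp; try exact: Kq.
      by case: ifP => _ //; exact: subring0.
    - rewrite hornerD hornerN !hornerZ hornerM.
      by apply: (ideal_ofB idM); do 2?apply: (ideal_ofM idM).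
    apply/leq_sizeP => j nj; rewrite rE.
    have -> : (j < size q - size p)%N = false by lia.
    have [jq|jq] := leqP (size q) j.
      have -> : q`_j = 0 by apply: nth_default.
      have -> : p`_(j - (size q - size p)) = 0.
        have h a b c : (a <= b <= c -> a <= c - (b - a))%N by lia.
        by apply/nth_default/h/andP.
      by rewrite !mulr0 subr0.
    have -> : j = (size q).-1 by lia.
    have -> : ((size q).-1 - (size q - size p) = (size p).-1)%N by lia.
    by rewrite -!lead_coefE mulrC subrr.
  rewrite hornerD hornerN !hornerZ hornerM pe !mulr0 subr0 => /eqP.
  by rewrite mulf_eq0 (negbTE lp0) => /eqP.
exists e; split; last by have := ideal_ofN idM Med; rewrite opprB.
apply: (maximal_subfield_adjoin mK) => _ [q Kq ->] Mqe; apply: vanish (leqnn _) => //.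
by apply: Mirr Mqe; apply/Mpi/horner_congr/Mpi.
Qed.

(** * Expansions in powers of the uniformizer *)

Section Expansions.
Variable K : D -> Prop.
Hypotheses (sK : subfield K) (resK : forall d, exists k, K k /\ M (d - k)).

Definition expansion (d : D) (f : nat -> D) : Prop :=
  forall n, divides (pi ^+ n) (d - \sum_(i < n) f i * pi ^+ i).

(** Repeatedly subtract a representative in [K] of the residue and divide by [pi]; [rest n] is the
    [n]-th quotient. *)
Lemma exists_expansion d : exists2 f, forall n, K (f n) & expansion d f.
Proof.
have /choice[k kP] := resK.
have /choice[t tP] : forall x, exists y, x - k x = y * pi.
  by move=> x; apply/Mpi; case: (kP x).
pose rest n := iter n t d.
exists (fun n => k (rest n)) => [n|n]; first by case: (kP (rest n)).
exists (rest n); elim: n => [|n IH]; first by rewrite big_ord0 subr0 mulr1.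
by rewrite big_ord_recr opprD addrA IH /= exprS mulrA -tP; ring.
Qed.

Lemma expansion_inj x y f : expansion x f -> expansion y f -> x = y.
Proof.
move=> xf yf; apply/eqP; rewrite -subr_eq0; apply/eqP/sep => n.
by have := dvdB (xf n) (yf n); congr divides; ring.
Qed.

(** If the digits below [n] agree, [(f n - g n) pi ^ n] is divisible by [pi ^ n.+1], so [f n - g n]
    lies in [K] and [M]. *)
Lemma expansion_unique d f g : (forall n, K (f n)) -> (forall n, K (g n)) ->
  expansion d f -> expansion d g -> forall n, f n = g n.
Proof.
move=> Kf Kg df dg; elim/ltn_ind => n IH.
have : divides (pi ^+ n.+1) (\sum_(i < n.+1) f i * pi ^+ i - \sum_(i < n.+1) g i * pi ^+ i).
  by have := dvdB (dg n.+1) (df n.+1); congr divides; ring.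
rewrite !big_ord_recr /= (eq_bigr (fun i : 'I_n => g i * pi ^+ i)) => [|i _]; last by rewrite IH.
rewrite opprD addrACA subrr add0r -mulrBl => -[c].
rewrite exprS mulrA => /(mulIf (expf_neq0 n pi0)) h.
apply/eqP; rewrite -subr_eq0; apply/eqP; apply: (subfield_max sK).
  exact: (subringB (subfield_subring sK)).
by apply/Mpi; exists c.
Qed.

Lemma expansion_add x y f g : expansion x f -> expansion y g -> expansion (x + y) (ps_add f g).
Proof.
move=> xf yg n; have := dvdD (xf n) (yg n); congr divides.
by under [in RHS]eq_bigr do rewrite mulrDl; rewrite big_split /=; ring.
Qed.

(** Truncate both series to polynomials: below degree [n] their product has the Cauchy coefficients,
    and the rest is a multiple of [pi ^ n]. *)
Lemma expansion_mul x y f g : expansion x f -> expansion y g -> expansion (x * y) (ps_mul f g).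
Proof.
move=> xf yg n.
pose P := \poly_(i < n) f i; pose Q := \poly_(i < n) g i.
have PQ : P.[pi] * Q.[pi] = (drop_poly n (P * Q)).[pi] * pi ^+ n + \sum_(i < n) ps_mul f g i * pi ^+ i.
  rewrite -hornerM -[in LHS](poly_take_drop n (P * Q)) hornerD hornerM hornerXn addrC; congr (_ + _).
  rewrite horner_poly; apply: eq_bigr => i _; congr (_ * _).
  rewrite coefM; apply: eq_bigr => j _; rewrite !coef_poly.
  have -> : (j < n)%N by apply: leq_ltn_trans (ltn_ord i); rewrite -ltnS.
  by have -> : (i - j < n)%N by apply: leq_ltn_trans (leq_subr _ _) (ltn_ord i).
have -> : x * y - \sum_(i < n) ps_mul f g i * pi ^+ i =
    x * (y - Q.[pi]) + Q.[pi] * (x - P.[pi]) + (drop_poly n (P * Q)).[pi] * pi ^+ n.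
  have -> : \sum_(i < n) ps_mul f g i * pi ^+ i =
     P.[pi] * Q.[pi] - (drop_poly n (P * Q)).[pi] * pi ^+ n by rewrite PQ; ring.
  ring.
apply: dvdD; last by exists (drop_poly n (P * Q)).[pi].
by apply: dvdD; apply: dvdMl; rewrite horner_poly.
Qed.

Lemma expansion_const c : expansion c (ps_const c).
Proof.
case=> [|n]; first by exists c; rewrite big_ord0 subr0 mulr1.
rewrite big_ord_recl big1 => [|i _]; last by rewrite mul0r.
by rewrite /ps_const /= mulr1 addr0 subrr; exact: dvd0.
Qed.

Lemma expansion_exists_sum f : exists d, expansion d f.
Proof.
have [k|L LP] := complete (u := fun n => \sum_(i < n) f i * pi ^+ i).
  by rewrite big_ord_recr /= addrAC subrr add0r; exists (f k).
by exists L => n; rewrite -opprB; apply: dvdN.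
Qed.

(** The map [phi] takes digits in [K]. Uniqueness of digits makes it a homomorphism, and
    completeness makes it surjective. *)
Lemma subfield_power_series : iso_power_series K.
Proof.
have /choice[phi phiP] : forall d, exists f, (forall n, K (f n)) /\ expansion d f.
  by move=> d; have [f] := exists_expansion d; exists f.
have rK := subfield_subring sK.
have phiK d n : K (phi d n) by case: (phiP d).
have phiE d : expansion d (phi d) by case: (phiP d).
have uniq d f : (forall n, K (f n)) -> expansion d f -> forall n, phi d n = f n.
  by move=> Kf df; apply: (expansion_unique _ _ (phiE d) df).
exists phi; split=> //.
- move=> x y xy; apply: (expansion_inj (phiE x)) => n.
  by under eq_bigr do rewrite xy; exact: phiE.
- by move=> f Kf; have [d df] := expansion_exists_sum f; exists d; apply: uniq.
split.
- move=> x y; apply: uniq; last exact: expansion_add.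
  by move=> n; apply: subringD.
- move=> x y; apply: uniq; last exact: expansion_mul.
  by move=> n; apply: subring_sum => // i _; apply: subringM.
move=> k Kk; apply: uniq; last exact: expansion_const.
by move=> n; rewrite /ps_const; case: eqP => _ //; exact: subring0.
Qed.

End Expansions.
End CompleteDVR.

Theorem theorem7 (D : idomainType) (M : D -> Prop) :
  local_ring M -> madic_complete M -> ~ is_field D -> residue_char0 M ->
  (AV_domain D \/ API_domain D) ->
  DVR D /\ exists K : D -> Prop, coefficient_field M K /\ iso_power_series K.
Proof.
move=> locM complM nfield char0 avapi.
have av : AV_domain D by case: avapi => // /(API_AV locM).
have pid : PID D.
  by apply: valuation_PID => [|a b]; [case: locM | exact: (AV_valuation locM)].
split; first by split=> //; exists M.
(* The generator of [M] is the uniformizer, nonzero because [D] is not a field. *)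
have [pi piM] := pid _ (max_idealM locM).
have Mpi x : M x <-> divides pi x by exact: piM.
have nM1 := max_ideal1 locM; have unitM := notin_max_unit locM.
have pi0 : pi != 0.
  apply/eqP => pi0; apply: nfield => x x0; apply: unitM => /Mpi[c].
  by rewrite pi0 mulr0 => h; rewrite h eqxx in x0.
have nU : pi \isn't a GRing.unit.
  apply/negP => /(unit_notin_max locM); apply; apply/Mpi; exists 1.
  by rewrite mul1r.
have sep := PID_separated pid nU pi0.
(* Telescoping shows that [u] is Cauchy; going through an index above both [N] and [k] gives its
   limit the explicit rate [pi ^ k]. *)
have complete (u : nat -> D) : (forall k, divides (pi ^+ k) (u k.+1 - u k)) ->
    exists L, forall k, divides (pi ^+ k) (u k - L).
  move=> up; have step k i : divides (pi ^+ k) (u (i + k)%N - u k).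
    elim: i => [|i IH]; first by rewrite subrr; exact: dvd0.
    rewrite -[u _](subrK (u (i + k)%N)) -addrA; apply: dvdD => //.
    by apply: dvd_trans (up _); apply/dvd_exp/leq_addl.
  have step' k i : (k <= i)%N -> divides (pi ^+ k) (u i - u k).
    by move=> ki; rewrite -(subnK ki); exact: step.
  have [k|L LP] := complM u.
    exists k => i j ki kj; apply/(ipow_principal k _ Mpi).
    by have := dvdB (step' k i ki) (step' k j kj); rewrite opprB addrA subrK.
  exists L => k; have [N /(_ (maxn N k) (leq_maxl _ _))] := LP k.
  move=> /(ipow_principal k _ Mpi) h.
  by have := dvdB h (step' _ _ (leq_maxr N k)); rewrite opprB addrC addrA subrK.
have [K mK] := exists_maximal_subfield Mpi unitM char0.
have resK d := maximal_subfield_residue pi0 Mpi nM1 unitM sep complete char0 d mK.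
have sK : subfield K by case: mK.
exists K; split; first by split=> // k; exact: (subfield_max Mpi nM1 sK).
exact: (subfield_power_series pi0 Mpi nM1 sep complete sK).
Qed.
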